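(* Let $\mathcal{C}$ be a pointed algebraically coherent category. If $\mathcal{C}$ is a Mal'tsev category, then it is protomodular.
   Context: A Mal'tsev category is a finitely complete category in which every (internal) reflexive relation is an equivalence relation. $\mathsf{Pt}_X(\mathcal{C})$ is the category of points over $X$: objects are triples $(A,\ p\colon A\to X,\ s\colon X\to A)$ with $ps=1_X$, and morphisms are morphisms between the objects $A$ commuting with the $p$'s and the $s$'s. For $f\colon X\to Y$, the change-of-base functor $f^*\colon \mathsf{Pt}_Y(\mathcal{C})\to\mathsf{Pt}_X(\mathcal{C})$ is pulling back along $f$. A category $\mathcal{C}$ is protomodular if it has pullbacks of split epimorphisms along any map and for every morphism $f$ the functor $f^*$ between categories of points reflects isomorphisms. A cospan $(f\colon X\to Z,\ g\colon Y\to Z)$ in a category with finite limits is jointly strongly epimorphic if every monomorphism into $Z$ through which both $f$ and $g$ factor is an isomorphism. A functor between categories with finite limits is coherent if it preserves finite limits and jointly strongly epimorphic pairs. A category $\mathcal{C}$ with finite limits is algebraically coherent if $f^*$ is coherent for every morphism $f$ of $\mathcal{C}$. *)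

(* Defs.v *)
From Stdlib Require Import ClassicalEpsilon ProofIrrelevance.
From Stdlib Require FinFun.

Set Implicit Arguments.
Unset Strict Implicit.
Unset Printing Implicit Defensive.

Declare Scope cat_scope.
Delimit Scope cat_scope with cat.
Local Open Scope cat_scope.

Record category := Category {
  obj :> Type;
  hom : obj -> obj -> Type;
  idm : forall X, hom X X;
  comp : forall X Y Z, hom Y Z -> hom X Y -> hom X Z;
  comp_idl : forall X Y (f : hom X Y), comp (idm Y) f = f;
  comp_idr : forall X Y (f : hom X Y), comp f (idm X) = f;
  comp_assoc : forall X Y Z W (h : hom Z W) (g : hom Y Z) (f : hom X Y),
    comp h (comp g f) = comp (comp h g) f
}.

Arguments idm {c} X.

Notation "g ∘ f" := (comp g f) (at level 40, left associativity) : cat_scope.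

Record functor (C D : category) := Functor {
  fobj :> C -> D;
  fmap : forall X Y : C, hom X Y -> hom (fobj X) (fobj Y);
  fmap_id : forall X : C, fmap (idm X) = idm (fobj X);
  fmap_comp : forall (X Y Z : C) (g : hom Y Z) (f : hom X Y),
    fmap (g ∘ f) = fmap g ∘ fmap f
}.

Arguments fmap {C D} f0 {X Y} _.

Program Definition functor_comp (C D E : category)
    (G : functor D E) (F : functor C D) : functor C E :=
  {| fobj := fun X => G (F X); fmap := fun X Y f => fmap G (fmap F f) |}.
Next Obligation. now rewrite !fmap_id. Qed.
Next Obligation. now rewrite !fmap_comp. Qed.

Section Morphisms.
Variable C : category.

Definition is_mono (X Y : C) (m : hom X Y) : Prop :=
  forall (W : C) (u v : hom W X), m ∘ u = m ∘ v -> u = v.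

Definition is_iso (X Y : C) (f : hom X Y) : Prop :=
  exists g : hom Y X, g ∘ f = idm X /\ f ∘ g = idm Y.

Definition is_terminal (T : C) : Prop :=
  forall X : C, exists! f : hom X T, True.

Definition is_initial (I : C) : Prop :=
  forall X : C, exists! f : hom I X, True.

Definition pointed : Prop := exists Z : C, is_terminal Z /\ is_initial Z.

Definition is_pullback (X Y Z : C) (f : hom X Z) (g : hom Y Z)
    (P : C) (p1 : hom P X) (p2 : hom P Y) : Prop :=
  f ∘ p1 = g ∘ p2 /\
  forall (Q : C) (q1 : hom Q X) (q2 : hom Q Y), f ∘ q1 = g ∘ q2 ->
    exists! u : hom Q P, p1 ∘ u = q1 /\ p2 ∘ u = q2.

Record pullback (X Y Z : C) (f : hom X Z) (g : hom Y Z) := Pullback {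
  pb_obj : C;
  pb_fst : hom pb_obj X;
  pb_snd : hom pb_obj Y;
  pb_is_pullback : is_pullback f g pb_fst pb_snd
}.

Definition jointly_strongly_epi (X Y Z : C) (f : hom X Z) (g : hom Y Z) : Prop :=
  forall (M : C) (m : hom M Z), is_mono m ->
    (exists f' : hom X M, m ∘ f' = f) ->
    (exists g' : hom Y M, m ∘ g' = g) ->
    is_iso m.

End Morphisms.

(* Finite limits: limits of all diagrams indexed by a category with finitely
   many objects and finitely many morphisms. *)

Definition finite_category (J : category) : Prop :=
  FinFun.Finite J /\ forall i j : J, FinFun.Finite (hom i j).

Definition is_cone (J C : category) (D : functor J C) (L : C)
    (l : forall j, hom L (D j)) : Prop :=
  forall (i j : J) (a : hom i j), fmap D a ∘ l i = l j.

Definition is_limit (J C : category) (D : functor J C) (L : C)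
    (l : forall j, hom L (D j)) : Prop :=
  is_cone l /\
  forall (Q : C) (q : forall j, hom Q (D j)), is_cone q ->
    exists! u : hom Q L, forall j, l j ∘ u = q j.

Definition has_finite_limits (C : category) : Prop :=
  forall (J : category), finite_category J ->
  forall D : functor J C, exists (L : C) (l : forall j, hom L (D j)), is_limit l.

Definition preserves_finite_limits (C D : category) (F : functor C D) : Prop :=
  forall (J : category), finite_category J ->
  forall (K : functor J C) (L : C) (l : forall j, hom L (K j)),
    is_limit l ->
    @is_limit J D (functor_comp F K) (F L) (fun j => fmap F (l j)).

Definition preserves_jointly_strongly_epi (C D : category) (F : functor C D) : Prop :=
  forall (X Y Z : C) (f : hom X Z) (g : hom Y Z),
    jointly_strongly_epi f g -> jointly_strongly_epi (fmap F f) (fmap F g).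

Definition coherent (C D : category) (F : functor C D) : Prop :=
  preserves_finite_limits F /\ preserves_jointly_strongly_epi F.

Definition reflects_isos (C D : category) (F : functor C D) : Prop :=
  forall (X Y : C) (f : hom X Y), is_iso (fmap F f) -> is_iso f.

Section Points.
Variable C : category.

Record point (X : C) := Point {
  pt_obj : C;
  pt_proj : hom pt_obj X;
  pt_sect : hom X pt_obj;
  pt_split : pt_proj ∘ pt_sect = idm X
}.

Record point_hom (X : C) (A B : point X) := PointHom {
  pt_map : hom (pt_obj A) (pt_obj B);
  pt_map_proj : pt_proj B ∘ pt_map = pt_proj A;
  pt_map_sect : pt_map ∘ pt_sect A = pt_sect B
}.

Lemma point_hom_eq (X : C) (A B : point X) (u v : point_hom A B) :
  pt_map u = pt_map v -> u = v.
Proof.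
destruct u as [u u1 u2], v as [v v1 v2]; simpl; intros <-.
now rewrite (proof_irrelevance _ u1 v1), (proof_irrelevance _ u2 v2).
Qed.

Program Definition point_id (X : C) (A : point X) : point_hom A A :=
  {| pt_map := idm (pt_obj A) |}.
Next Obligation. apply comp_idr. Qed.
Next Obligation. apply comp_idl. Qed.

Program Definition point_comp (X : C) (A B D : point X)
    (v : point_hom B D) (u : point_hom A B) : point_hom A D :=
  {| pt_map := pt_map v ∘ pt_map u |}.
Next Obligation. now rewrite comp_assoc, !pt_map_proj. Qed.
Next Obligation. now rewrite <- comp_assoc, !pt_map_sect. Qed.

Program Definition Pt (X : C) : category :=
  {| obj := point X; hom := @point_hom X;
     idm := @point_id X; comp := @point_comp X |}.
Next Obligation. apply point_hom_eq, comp_idl. Qed.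
Next Obligation. apply point_hom_eq, comp_idr. Qed.
Next Obligation. apply point_hom_eq, comp_assoc. Qed.

Definition has_split_epi_pullbacks : Prop :=
  forall (X Y : C) (f : hom X Y) (B : point Y), inhabited (pullback f (pt_proj B)).

End Points.

Section ChangeOfBase.
Variables (C : category) (pbs : has_split_epi_pullbacks C).

(* The pullbacks defining the functor are picked by the axiom of choice;
   another choice gives a naturally isomorphic functor. *)
Definition chosen_pullback (X Y : C) (f : hom X Y) (B : point Y) :
    pullback f (pt_proj B) :=
  epsilon (pbs f B) (fun _ => True).

Definition pb_lift (X Y Z : C) (f : hom X Z) (g : hom Y Z) (P : pullback f g)
    (Q : C) (q1 : hom Q X) (q2 : hom Q Y) (e : f ∘ q1 = g ∘ q2) : hom Q (pb_obj P) :=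
  proj1_sig (constructive_indefinite_description _
    (proj2 (pb_is_pullback P) Q q1 q2 e)).

Lemma pb_lift_fst (X Y Z : C) (f : hom X Z) (g : hom Y Z) (P : pullback f g)
    (Q : C) (q1 : hom Q X) (q2 : hom Q Y) (e : f ∘ q1 = g ∘ q2) :
  pb_fst P ∘ pb_lift P e = q1.
Proof. unfold pb_lift; destruct constructive_indefinite_description as [u [[? ?] ?]]; auto. Qed.

Lemma pb_lift_snd (X Y Z : C) (f : hom X Z) (g : hom Y Z) (P : pullback f g)
    (Q : C) (q1 : hom Q X) (q2 : hom Q Y) (e : f ∘ q1 = g ∘ q2) :
  pb_snd P ∘ pb_lift P e = q2.
Proof. unfold pb_lift; destruct constructive_indefinite_description as [u [[? ?] ?]]; auto. Qed.

Lemma pb_hom_eq (X Y Z : C) (f : hom X Z) (g : hom Y Z) (P : pullback f g)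
    (Q : C) (u v : hom Q (pb_obj P)) :
  pb_fst P ∘ u = pb_fst P ∘ v -> pb_snd P ∘ u = pb_snd P ∘ v -> u = v.
Proof.
destruct (pb_is_pullback P) as [c univ]; intros e1 e2.
destruct (univ Q (pb_fst P ∘ v) (pb_snd P ∘ v)) as [w [_ uniq]].
- now rewrite !comp_assoc, c.
- now rewrite <- (uniq u (conj e1 e2)), <- (uniq v (conj eq_refl eq_refl)).
Qed.

Lemma cob_sect_eq (X Y : C) (f : hom X Y) (B : point Y) :
  f ∘ idm X = pt_proj B ∘ (pt_sect B ∘ f).
Proof. now rewrite comp_assoc, pt_split, comp_idl, comp_idr. Qed.

Definition cob_obj (X Y : C) (f : hom X Y) (B : point Y) : point X :=
  {| pt_obj := pb_obj (chosen_pullback f B);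
     pt_proj := pb_fst (chosen_pullback f B);
     pt_sect := pb_lift (chosen_pullback f B) (cob_sect_eq f B);
     pt_split := pb_lift_fst _ (cob_sect_eq f B) |}.

Lemma cob_map_eq (X Y : C) (f : hom X Y) (A B : point Y) (u : point_hom A B) :
  f ∘ pb_fst (chosen_pullback f A) =
  pt_proj B ∘ (pt_map u ∘ pb_snd (chosen_pullback f A)).
Proof. now rewrite comp_assoc, pt_map_proj, (proj1 (pb_is_pullback _)). Qed.

Program Definition cob_map (X Y : C) (f : hom X Y) (A B : point Y)
    (u : point_hom A B) : point_hom (cob_obj f A) (cob_obj f B) :=
  {| pt_map := pb_lift (chosen_pullback f B) (cob_map_eq f u) |}.
Next Obligation. apply pb_lift_fst. Qed.
Next Obligation.
apply pb_hom_eq; rewrite comp_assoc.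
- now rewrite !pb_lift_fst.
- now rewrite !pb_lift_snd, <- comp_assoc, pb_lift_snd, comp_assoc, pt_map_sect.
Qed.

Program Definition change_of_base (X Y : C) (f : hom X Y) : functor (Pt Y) (Pt X) :=
  {| fobj := cob_obj f : Pt Y -> Pt X; fmap := cob_map f |}.
Next Obligation.
apply point_hom_eq, pb_hom_eq; simpl.
- now rewrite pb_lift_fst, comp_idr.
- now rewrite pb_lift_snd, comp_idl, comp_idr.
Qed.
Next Obligation.
apply point_hom_eq, pb_hom_eq; simpl; rewrite comp_assoc.
- now rewrite !pb_lift_fst.
- now rewrite !pb_lift_snd, <- !comp_assoc, pb_lift_snd.
Qed.

End ChangeOfBase.

(* A category with finite limits has pullbacks, as limits of diagrams indexed
   by the walking cospan. *)

Inductive cospan_obj : Set := cospan_left | cospan_right | cospan_base.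

Definition cospan_hom (i j : cospan_obj) : Set :=
  match i, j with
  | cospan_left, cospan_right | cospan_right, cospan_left
  | cospan_base, cospan_left | cospan_base, cospan_right => Empty_set
  | _, _ => unit
  end.

Definition cospan_id (i : cospan_obj) : cospan_hom i i :=
  match i with cospan_left | cospan_right | cospan_base => tt end.

Definition cospan_comp (i j k : cospan_obj) :
  cospan_hom j k -> cospan_hom i j -> cospan_hom i k.
Proof. destruct i, j, k; simpl; intros [] []; exact tt. Defined.

Lemma cospan_hom_eq (i j : cospan_obj) (a b : cospan_hom i j) : a = b.
Proof. now destruct i, j, a, b. Qed.

Definition cospan : category :=
  {| obj := cospan_obj; hom := cospan_hom; idm := cospan_id; comp := cospan_comp;
     comp_idl := fun _ _ _ => cospan_hom_eq _ _;
     comp_idr := fun _ _ _ => cospan_hom_eq _ _;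
     comp_assoc := fun _ _ _ _ _ _ _ => cospan_hom_eq _ _ |}.

Lemma finite_cospan : finite_category cospan.
Proof.
split.
- exists (cons cospan_left (cons cospan_right (cons cospan_base nil))).
  intros []; simpl; auto.
- intros [] []; simpl;
    first [exists nil; intros []; fail | exists (cons tt nil); intros []; simpl; auto].
Qed.

Section CospanDiagram.
Variables (C : category) (X Y Z : C) (f : hom X Z) (g : hom Y Z).

Definition cospan_diagram_obj (i : cospan) : C :=
  match i with cospan_left => X | cospan_right => Y | cospan_base => Z end.

Definition cospan_diagram_map (i j : cospan) :
  hom i j -> hom (cospan_diagram_obj i) (cospan_diagram_obj j) :=
  match i, j with
  | cospan_left, cospan_left => fun _ => idm X
  | cospan_right, cospan_right => fun _ => idm Y
  | cospan_base, cospan_base => fun _ => idm Z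
  | cospan_left, cospan_base => fun _ => f
  | cospan_right, cospan_base => fun _ => g
  | _, _ => fun a : Empty_set => match a with end
  end.

Program Definition cospan_diagram : functor cospan C :=
  {| fobj := cospan_diagram_obj; fmap := cospan_diagram_map |}.
Next Obligation. now destruct X0. Qed.
Next Obligation.
destruct X0, Y0, Z0; simpl in *; try destruct f0; try destruct g0;
  now rewrite ?comp_idl, ?comp_idr.
Qed.

Lemma pullback_of_finite_limits : has_finite_limits C -> inhabited (pullback f g).
Proof.
intros lim; destruct (lim _ finite_cospan cospan_diagram) as [L [l [cone univ]]].
constructor; exists L (l cospan_left) (l cospan_right); split.
- transitivity (l cospan_base).
  + exact (cone cospan_left cospan_base tt).
  + symmetry; exact (cone cospan_right cospan_base tt).
- intros Q q1 q2 e.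
  destruct (univ Q (fun j => match j with
    | cospan_left => q1 | cospan_right => q2 | cospan_base => f ∘ q1 end))
    as [u [hu uniq]].
  + intros [] [] []; simpl; rewrite ?comp_idl; auto.
  + exists u; split.
    * exact (conj (hu cospan_left) (hu cospan_right)).
    * intros v [h1 h2]; apply uniq; intros []; simpl; auto.
      transitivity (f ∘ l cospan_left ∘ v).
      -- f_equal; symmetry; exact (cone cospan_left cospan_base tt).
      -- rewrite <- comp_assoc; exact (f_equal (comp f) h1).
Qed.

End CospanDiagram.

Lemma split_epi_pullbacks_of_finite_limits (C : category) :
  has_finite_limits C -> has_split_epi_pullbacks C.
Proof. intros lim X Y f B; now apply pullback_of_finite_limits. Qed.

Definition algebraically_coherent (C : category) : Prop :=
  exists lim : has_finite_limits C,
    forall (X Y : C) (f : hom X Y),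
      coherent (change_of_base (split_epi_pullbacks_of_finite_limits lim) f).

Definition protomodular (C : category) : Prop :=
  exists pbs : has_split_epi_pullbacks C,
    forall (X Y : C) (f : hom X Y), reflects_isos (change_of_base pbs f).

Section Relations.
Variables (C : category) (X R : C) (r1 r2 : hom R X).

Definition is_relation : Prop :=
  forall (W : C) (u v : hom W R), r1 ∘ u = r1 ∘ v -> r2 ∘ u = r2 ∘ v -> u = v.

Definition is_reflexive : Prop :=
  exists e : hom X R, r1 ∘ e = idm X /\ r2 ∘ e = idm X.

Definition is_symmetric : Prop :=
  exists s : hom R R, r1 ∘ s = r2 /\ r2 ∘ s = r1.

(* [P] is the object of pairs ((x, y), (y, z)) of elements of [R]. *)
Definition is_transitive : Prop :=
  forall (P : C) (p1 p2 : hom P R), is_pullback r2 r1 p1 p2 ->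
    exists t : hom P R, r1 ∘ t = r1 ∘ p1 /\ r2 ∘ t = r2 ∘ p2.

Definition is_equivalence_relation : Prop :=
  is_relation /\ is_reflexive /\ is_symmetric /\ is_transitive.

End Relations.

Definition maltsev (C : category) : Prop :=
  has_finite_limits C /\
  forall (X R : C) (r1 r2 : hom R X),
    is_relation r1 r2 -> is_reflexive r1 r2 -> is_equivalence_relation r1 r2.

(* Main.v *)
Require Import Defs.

Set Implicit Arguments.
Unset Strict Implicit.
Unset Printing Implicit Defensive.
Local Open Scope cat_scope.

(** Write Z for the zero object.  The heart of the matter is that for every
    point (A, p, s) over X, the section s and the kernel k of p are jointly
    strongly epimorphic; protomodularity then follows by a standard argument.

    Coherence of the change-of-base functor along Z -> X, the kernel functor,
    reduces this to finding a jointly strongly epimorphic pair of points over X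
    whose image under the kernel functor is (s, k).  Such a pair is
<<
      (X × X, π1, <1, 1>) --(1 × s)--> (X × A, π1, <1, s>) <--<p, 1>-- (A, p, s).
>>
    The kernel of π1 on X × A is A, and on kernels the two morphisms become
    s : X -> A and k : K -> A.  They are jointly strongly epimorphic because in
    a Mal'tsev category every relation is difunctional: a relation from X to A
    containing all pairs (x, s y) and all pairs (p a, a) contains (x, s (p a)),
    (p a, s (p a)) and (p a, a), hence also (x, a), for arbitrary x and a.

    Now let u : A -> B be a morphism of points over Y which a change-of-base
    functor inverts.  It restricts to a bijection between the generalized
    elements of the kernels.  The diagonal of the kernel pair of u therefore
    contains the section and the kernel of the point formed by that kernel pair,
    so it is an isomorphism and u is a monomorphism.  As the image of u contains
    the section and the kernel of B, u is an isomorphism. *)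

(** * Monomorphisms and pullbacks *)

Lemma mono_section_iso (C : category) (X Y : C) (m : hom X Y) (r : hom Y X) :
  is_mono m -> m ∘ r = idm Y -> is_iso m.
Proof.
intros hm hr; exists r; split; [apply hm | exact hr].
now rewrite comp_assoc, hr, comp_idl, comp_idr.
Qed.

Lemma pb_comm (C : category) (X Y Z : C) (f : hom X Z) (g : hom Y Z)
    (P : pullback f g) : f ∘ pb_fst P = g ∘ pb_snd P.
Proof. exact (proj1 (pb_is_pullback P)). Qed.

Lemma pb_lift_ex (C : category) (X Y Z : C) (f : hom X Z) (g : hom Y Z)
    (P : pullback f g) (Q : C) (q1 : hom Q X) (q2 : hom Q Y) :
  f ∘ q1 = g ∘ q2 ->
  exists u : hom Q (pb_obj P), pb_fst P ∘ u = q1 /\ pb_snd P ∘ u = q2.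
Proof.
intros e; exists (pb_lift P e); split; [apply pb_lift_fst | apply pb_lift_snd].
Qed.

Lemma terminal_eq (C : category) (T X : C) (u v : hom X T) : is_terminal T -> u = v.
Proof.
intros hT; destruct (hT X) as [w [_ uniq]].
now rewrite <- (uniq u I), <- (uniq v I).
Qed.

Lemma initial_eq (C : category) (T X : C) (u v : hom T X) : is_initial T -> u = v.
Proof.
intros hT; destruct (hT X) as [w [_ uniq]].
now rewrite <- (uniq u I), <- (uniq v I).
Qed.

(** The kernel pair of [m] in [C] is again a point, with section the diagonal
    of that of [M], so its projections are morphisms of points and [m] can be
    cancelled from them; any pair with equal composites with [m] factors through them. *)
Lemma point_mono_mono (C : category) (lim : has_finite_limits C) (X : C)
    (M A : Pt X) (m : hom M A) : is_mono m -> is_mono (pt_map m).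
Proof.
intros hm W u v e.
destruct (pullback_of_finite_limits (pt_map m) (pt_map m) lim) as [P].
destruct (pb_lift_ex P (q1 := pt_sect M) (q2 := pt_sect M) eq_refl)
  as [d [d1 d2]].
assert (split : pt_proj M ∘ pb_fst P ∘ d = idm X)
  by now rewrite <- comp_assoc, d1, pt_split.
pose (K := Point split : Pt X).
assert (e2 : pt_proj M ∘ pb_snd P = pt_proj M ∘ pb_fst P)
  by now rewrite <- (pt_map_proj m), <- !comp_assoc, pb_comm.
pose (k1 := @PointHom C X K M (pb_fst P) eq_refl d1 : hom K M).
pose (k2 := @PointHom C X K M (pb_snd P) e2 d2 : hom K M).
assert (ek : k1 = k2) by (apply hm, point_hom_eq, pb_comm).
destruct (pb_lift_ex P e) as [w [<- <-]].
now rewrite (f_equal (@pt_map _ _ _ _) ek : pb_fst P = pb_snd P).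
Qed.

Lemma point_iso (C : category) (X : C) (A B : Pt X) (u : hom A B) :
  is_iso (pt_map u) -> is_iso u.
Proof.
intros [v [vu uv]].
assert (vp : pt_proj A ∘ v = pt_proj B)
  by now rewrite <- (pt_map_proj u), <- comp_assoc, uv, comp_idr.
assert (vs : v ∘ pt_sect B = pt_sect A)
  by now rewrite <- (pt_map_sect u), comp_assoc, vu, comp_idl.
exists (@PointHom C X B A v vp vs); split; now apply point_hom_eq.
Qed.

(** * Difunctionality *)

(** On [R] itself, relate [a] to [b] when (r1 a, r2 b) lies in [R].  This
    relation is reflexive, so it is symmetric; the hypotheses say that [b] is
    related to [a], and the conclusion is that [a] is related to [b]. *)
Lemma maltsev_difunctional (C : category) (X Y R : C) (r1 : hom R X) (r2 : hom R Y)
    (W : C) (a b c : hom W R) :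
  maltsev C ->
  (forall (V : C) (u v : hom V R), r1 ∘ u = r1 ∘ v -> r2 ∘ u = r2 ∘ v -> u = v) ->
  r1 ∘ c = r1 ∘ b -> r2 ∘ c = r2 ∘ a ->
  exists d : hom W R, r1 ∘ d = r1 ∘ a /\ r2 ∘ d = r2 ∘ b.
Proof.
intros [lim malt] rel e1 e2.
(* [S] consists of the triples (x, z, y) with z = (r1 x, r2 y). *)
destruct (pullback_of_finite_limits r1 r1 lim) as [P].
destruct (pullback_of_finite_limits (r2 ∘ pb_snd P) r2 lim) as [S].
assert (hP := pb_comm P); assert (hS := pb_comm S).
destruct (malt R (pb_obj S) (pb_fst P ∘ pb_fst S) (pb_snd S)) as [_ [_ [sym _]]].
- intros V u v h1 h2; rewrite <- !comp_assoc in h1.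
  apply pb_hom_eq; [apply pb_hom_eq |]; auto.
  apply rel.
  + now rewrite !comp_assoc, <- hP, <- !comp_assoc, h1.
  + now rewrite !comp_assoc, hS, <- !comp_assoc, h2.
- destruct (pb_lift_ex P (q1 := idm R) (q2 := idm R) eq_refl) as [d [d1 d2]].
  destruct (pb_lift_ex S (q1 := d) (q2 := idm R)) as [t [t1 t2]].
  { now rewrite <- comp_assoc, d2. }
  exists t; split; [now rewrite <- comp_assoc, t1 | exact t2].
- destruct sym as [s [s1 s2]].
  destruct (pb_lift_ex P (q1 := b) (q2 := c)) as [d [d1 d2]]; [auto |].
  destruct (pb_lift_ex S (q1 := d) (q2 := a)) as [t [t1 t2]].
  { now rewrite <- comp_assoc, d2. }
  exists (pb_snd P ∘ pb_fst S ∘ s ∘ t); split.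
  + rewrite <- t2, <- s1, !comp_assoc, hP; reflexivity.
  + rewrite !comp_assoc, hS, <- (comp_assoc r2), s2, <- !comp_assoc, t1, d1.
    reflexivity.
Qed.

(** * Section and kernel are jointly strongly epimorphic *)

(** The kernel of this point is B, whatever h is: the choice of h makes it
    possible to view a given morphism into B as the kernel of a morphism of
    points. *)
Definition graph_point (C : category) (T : C) (hT : is_terminal T) (X B : C)
    (x : hom X T) (b : hom B T) (P : pullback x b) (h : hom X B) : Pt X :=
  let e := terminal_eq (x ∘ idm X) (b ∘ h) hT in
  @Point C X (pb_obj P) (pb_fst P) (pb_lift P e) (pb_lift_fst P e).

(** Here [i] and [j] are necessarily 1 × s and <p, 1>.  A subobject of X × A
    containing their images contains, for all x and a, the pairs (x, s (p a)),
    (p a, s (p a)) and (p a, a), hence by difunctionality (x, a). *)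
Lemma graph_point_strongly_epi (C : category) (T : C) (hT : is_terminal T)
    (X : C) (A : Pt X) (x : hom X T) (a : hom (pt_obj A) T)
    (XX : pullback x x) (XA : pullback x a)
    (i : hom (graph_point hT XX (idm X)) (graph_point hT XA (pt_sect A)))
    (j : hom A (graph_point hT XA (pt_sect A))) :
  maltsev C ->
  pb_snd XA ∘ pt_map i = pt_sect A ∘ pb_snd XX ->
  pb_snd XA ∘ pt_map j = idm (pt_obj A) ->
  jointly_strongly_epi i j.
Proof.
intros malt i2 j2 M m hm [i' hi] [j' hj].
apply (point_mono_mono (proj1 malt)) in hm.
(* Forget the sections, and regard everything as morphisms of [C]. *)
pose (n := pt_map m : hom (pt_obj M) (pb_obj XA)).
pose (i0 := pt_map i : hom (pb_obj XX) (pb_obj XA)).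
pose (j0 := pt_map j : hom (pt_obj A) (pb_obj XA)).
pose (k := pt_map i' : hom (pb_obj XX) (pt_obj M)).
pose (l := pt_map j' : hom (pt_obj A) (pt_obj M)).
assert (i1 : pb_fst XA ∘ i0 = pb_fst XX) by exact (pt_map_proj i).
assert (j1 : pb_fst XA ∘ j0 = pt_proj A) by exact (pt_map_proj j).
assert (hk : n ∘ k = i0) by exact (f_equal (@pt_map _ _ _ _) hi).
assert (hl : n ∘ l = j0) by exact (f_equal (@pt_map _ _ _ _) hj).
change (pb_snd XA ∘ i0 = pt_sect A ∘ pb_snd XX) in i2.
change (pb_snd XA ∘ j0 = idm (pt_obj A)) in j2.
pose (sp := pt_proj A ∘ pb_snd XA).
destruct (pb_lift_ex XX (q1 := pb_fst XA) (q2 := sp)) as [u [u1 u2]];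
  [now apply terminal_eq |].
destruct (pb_lift_ex XX (q1 := sp) (q2 := sp)) as [v [v1 v2]];
  [now apply terminal_eq |].
destruct (@maltsev_difunctional C X (pt_obj A) (pt_obj M)
  (pb_fst XA ∘ n) (pb_snd XA ∘ n) (pb_obj XA)
  (k ∘ u) (l ∘ pb_snd XA) (k ∘ v) malt) as [d [d1 d2]].
- intros V f g h1 h2; rewrite <- !comp_assoc in h1, h2.
  now apply hm, pb_hom_eq.
- rewrite <- !comp_assoc, !(comp_assoc n), hk, hl, !comp_assoc, i1, j1.
  exact v1.
- rewrite <- !comp_assoc, !(comp_assoc n), hk, !comp_assoc, i2.
  now rewrite <- !comp_assoc, u2, v2.
- rewrite <- !comp_assoc, !(comp_assoc n), hk, !comp_assoc, i1, u1 in d1.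
  rewrite <- !comp_assoc, !(comp_assoc n), hl, !comp_assoc, j2, comp_idl in d2.
  apply point_iso, mono_section_iso with (r := d); [exact hm |].
  apply pb_hom_eq; now rewrite comp_idr, comp_assoc.
Qed.

(** The kernel functor sends the pair of [graph_point_strongly_epi] to the
    section and the kernel of [A], up to the isomorphism between [A] and the
    kernel of X × A.  The kernel of [A] enters only through its generalized
    elements, the morphisms [t] whose composite with the projection is null. *)
Lemma section_kernel_strongly_epi (C : category) (lim : has_finite_limits C)
    (Z : C) (hT : is_terminal Z) (hI : is_initial Z) (X : C) (z : hom Z X) :
  maltsev C ->
  preserves_jointly_strongly_epi
    (change_of_base (split_epi_pullbacks_of_finite_limits lim) z) ->
  forall (A : Pt X) (M : C) (m : hom M (pt_obj A)), is_mono m ->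
  (exists s, m ∘ s = pt_sect A) ->
  (forall (W : C) (t : hom W (pt_obj A)) (w : hom W Z),
    pt_proj A ∘ t = z ∘ w -> exists t', m ∘ t' = t) ->
  is_iso m.
Proof.
intros malt pres A M m hm [s hs] hk.
set (pbs := split_epi_pullbacks_of_finite_limits lim) in *.
destruct (hT X) as [x _]; destruct (hT (pt_obj A)) as [a _].
destruct (pullback_of_finite_limits x x lim) as [XX].
destruct (pullback_of_finite_limits x a lim) as [XA].
pose (D := graph_point hT XX (idm X)).
pose (E := graph_point hT XA (pt_sect A)).
destruct (pb_lift_ex XA (q1 := pb_fst XX) (q2 := pt_sect A ∘ pb_snd XX))
  as [i [i1 i2]]; [now apply terminal_eq |].
destruct (pb_lift_ex XA (q1 := pt_proj A) (q2 := idm (pt_obj A)))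
  as [j [j1 j2]]; [now apply terminal_eq |].
assert (is : i ∘ pt_sect D = pt_sect E).
{ apply pb_hom_eq; simpl; rewrite comp_assoc.
  - now rewrite i1, !pb_lift_fst.
  - now rewrite i2, <- comp_assoc, !pb_lift_snd, comp_idr. }
assert (js : j ∘ pt_sect A = pt_sect E).
{ apply pb_hom_eq; simpl; rewrite comp_assoc.
  - now rewrite j1, pb_lift_fst, pt_split.
  - now rewrite j2, pb_lift_snd, comp_idl. }
pose (I := @PointHom C X D E i i1 is : hom D E).
pose (J := @PointHom C X A E j j1 js : hom A E).
assert (strong := pres _ _ _ _ _
  (@graph_point_strongly_epi C Z hT X A x a XX XA I J malt i2 j2)).
pose (PE := chosen_pullback pbs z E).
pose (PD := chosen_pullback pbs z D).
pose (PA := chosen_pullback pbs z A).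
pose (q := pb_snd XA ∘ pb_snd PE).
(* The pullback of [m] along [q] is a subobject of the kernel of X × A. *)
destruct (pullback_of_finite_limits q m lim) as [N].
destruct (hI (pb_obj N)) as [n0 _].
pose (NP := @Point C Z (pb_obj N) (pb_fst PE ∘ pb_fst N) n0
  (terminal_eq _ _ hT) : Pt Z).
pose (n := @PointHom C Z NP (cob_obj pbs z E) (pb_fst N) eq_refl
  (initial_eq _ _ hI) : @hom (Pt Z) NP (cob_obj pbs z E)).
assert (lifts : forall (L : Pt Z) (l : @hom (Pt Z) L (cob_obj pbs z E)),
  (exists l', m ∘ l' = q ∘ pt_map l) -> exists l', n ∘ l' = l).
{ intros L l [l' hl].
  destruct (pb_lift_ex N (eq_sym hl)) as [r [r1 _]].
  exists (@PointHom C Z L NP r (terminal_eq _ _ hT) (initial_eq _ _ hI)).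
  apply point_hom_eq; exact r1. }
destruct (strong NP n) as [r [_ hr]].
- intros V f g e; apply point_hom_eq.
  assert (e1 : pb_fst N ∘ pt_map f = pb_fst N ∘ pt_map g)
    by exact (f_equal (@pt_map _ _ _ _) e).
  apply pb_hom_eq; [exact e1 |].
  apply hm; now rewrite !comp_assoc, <- pb_comm, <- !comp_assoc, e1.
- apply lifts; exists (s ∘ pb_snd XX ∘ pb_snd PD); simpl.
  unfold q; rewrite <- (comp_assoc (pb_snd XA)).
  unfold PE; rewrite pb_lift_snd; simpl.
  now rewrite !comp_assoc, i2, hs.
- apply lifts, (hk _ _ (pb_fst PA)); simpl.
  unfold q; rewrite <- (comp_assoc (pb_snd XA)).
  unfold PE; rewrite pb_lift_snd; simpl.
  rewrite (comp_assoc (pb_snd XA)), j2, comp_idl.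
  symmetry; exact (pb_comm PA).
- pose (r0 := pt_map r : hom (pb_obj PE) (pb_obj N)).
  assert (hr0 : pb_fst N ∘ r0 = idm (pb_obj PE))
    by exact (f_equal (@pt_map _ _ _ _) hr).
  (* [a'] maps [A] to the kernel {0} × A of π1. *)
  destruct (pb_lift_ex XA (q1 := z ∘ a) (q2 := idm (pt_obj A))) as [b [b1 b2]];
    [now apply terminal_eq |].
  destruct (pb_lift_ex PE (q1 := a) (q2 := b)) as [a' [_ a2]]; [now symmetry |].
  apply mono_section_iso with (r := pb_snd N ∘ r0 ∘ a'); [exact hm |].
  rewrite !comp_assoc, <- pb_comm, <- (comp_assoc q), hr0, comp_idr.
  rewrite <- b2, <- a2; symmetry; apply comp_assoc.
Qed.

(** * Protomodularity *)

(** A generalized element of the pullback of A along f is an element of A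
    together with a lifting along f of its projection to Y.  Stated in terms of
    elements, the hypothesis applies without any choice of kernels to the null
    projections Z -> X -> Y. *)
Lemma change_of_base_iso_bijective (C : category) (pbs : has_split_epi_pullbacks C)
    (X Y : C) (f : hom X Y) (A B : Pt Y) (u : hom A B) :
  is_iso (fmap (change_of_base pbs f) u) ->
  forall (W : C) (w : hom W X),
  (forall b : hom W (pt_obj B), pt_proj B ∘ b = f ∘ w ->
    exists a, pt_map u ∘ a = b) /\
  (forall a a' : hom W (pt_obj A), pt_proj A ∘ a = f ∘ w ->
    pt_map u ∘ a = pt_map u ∘ a' -> a = a').
Proof.
intros [v [vu uv]] W w.
pose (PA := chosen_pullback pbs f A).
pose (PB := chosen_pullback pbs f B).
pose (fu := pb_lift PB (cob_map_eq pbs f u) : hom (pb_obj PA) (pb_obj PB)).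
pose (fv := pt_map v : hom (pb_obj PB) (pb_obj PA)).
assert (vu0 : fv ∘ fu = idm _) by exact (f_equal (@pt_map _ _ _ _) vu).
assert (uv0 : fu ∘ fv = idm _) by exact (f_equal (@pt_map _ _ _ _) uv).
assert (fu1 : pb_fst PB ∘ fu = pb_fst PA) by apply pb_lift_fst.
assert (fu2 : pb_snd PB ∘ fu = pt_map u ∘ pb_snd PA) by apply pb_lift_snd.
split.
- intros b hb; symmetry in hb.
  destruct (pb_lift_ex PB hb) as [c [_ c2]].
  exists (pb_snd PA ∘ (fv ∘ c)).
  now rewrite !comp_assoc, <- fu2, <- (comp_assoc (pb_snd PB)), uv0, comp_idr.
- intros a a' ha e.
  assert (ha' : pt_proj A ∘ a' = f ∘ w)
    by now rewrite <- ha, <- (pt_map_proj u), <- !comp_assoc, e.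
  symmetry in ha, ha'.
  destruct (pb_lift_ex PA ha) as [c [c1 c2]].
  destruct (pb_lift_ex PA ha') as [c' [c1' c2']].
  assert (ec : fu ∘ c = fu ∘ c').
  { apply pb_hom_eq; rewrite !comp_assoc.
    - now rewrite fu1, c1, c1'.
    - now rewrite fu2, <- !comp_assoc, c2, c2'. }
  rewrite <- c2, <- c2', <- (comp_idl c), <- (comp_idl c'), <- vu0.
  now rewrite <- !(comp_assoc fv), ec.
Qed.

Theorem theorem6p2 (C : category) (C_pointed : pointed C)
    (C_coherent : algebraically_coherent C) (C_maltsev : maltsev C) :
  protomodular C.
Proof.
destruct C_pointed as [Z [hT hI]], C_coherent as [lim coh].
exists (split_epi_pullbacks_of_finite_limits lim).
intros X Y f A B u hu; apply point_iso.
assert (bij := change_of_base_iso_bijective hu).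
destruct (hI X) as [zX _].
assert (strong := section_kernel_strongly_epi hT hI C_maltsev
  (proj2 (coh Z Y (f ∘ zX)))).
(* The diagonal [d] of the kernel pair [R] is shown to be invertible: a pair
   in the kernel of [R] consists of two null elements with the same image. *)
assert (u_mono : is_mono (pt_map u)).
{ destruct (pullback_of_finite_limits (pt_map u) (pt_map u) lim) as [R].
  destruct (pb_lift_ex R (q1 := pt_sect A) (q2 := pt_sect A) eq_refl)
    as [s [s1 s2]].
  destruct (pb_lift_ex R (q1 := idm (pt_obj A)) (q2 := idm (pt_obj A)) eq_refl)
    as [d [d1 d2]].
  assert (split : pt_proj A ∘ pb_fst R ∘ s = idm Y)
    by now rewrite <- comp_assoc, s1, pt_split.
  destruct (strong (Point split) _ d) as [r [_ dr]]; simpl.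
  - intros W v w e.
    now rewrite <- (comp_idl v), <- (comp_idl w), <- d1, <- !comp_assoc, e.
  - exists (pt_sect A).
    apply pb_hom_eq; rewrite comp_assoc.
    + now rewrite d1, comp_idl, s1.
    + now rewrite d2, comp_idl, s2.
  - intros W t w e; exists (pb_fst R ∘ t).
    apply pb_hom_eq; rewrite comp_assoc.
    + now rewrite d1, comp_idl.
    + rewrite d2, comp_idl; apply (proj2 (bij W (zX ∘ w))).
      * now rewrite !comp_assoc.
      * now rewrite !comp_assoc, pb_comm.
  - simpl in r, dr.
    assert (eR : pb_fst R = pb_snd R)
      by now rewrite <- (comp_idr (pb_fst R)), <- (comp_idr (pb_snd R)), <- dr,
        !comp_assoc, d1, d2.
    intros W v w e; destruct (pb_lift_ex R e) as [t [<- <-]].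
    now rewrite eR. }
apply (strong B _ _ u_mono).
- exists (pt_sect A); apply pt_map_sect.
- intros W t w e; apply (proj1 (bij W (zX ∘ w))).
  now rewrite comp_assoc.
Qed.
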